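(* Let $n,d,L$ be positive integers. There exists a bijection $\Phi$ from the set of permutations $\pi\in S_n$ that avoid both patterns $d\cdots 1(d+1)$ and $1\cdots(L+1)$ to the set of pairs $(P,Q)$ of $(d,L)$-cylindric standard Young tableaux of size $n$ with $\mathrm{sh}(P)=\mathrm{sh}(Q)$. Moreover, if $\Phi(\pi)=(P,Q)$ then $\Phi(\pi^{-1})=(Q,P)$.
   Context: A permutation $\pi\in S_n$ (in one-line notation $\pi(1)\cdots\pi(n)$) avoids the pattern $1\cdots(L+1)$ if it has no increasing subsequence of length $L+1$. It avoids $d\cdots 1(d+1)$ if there are no indices $i_1<\dots<i_d<i_{d+1}$ with $\pi(i_1)>\pi(i_2)>\dots>\pi(i_d)$ and $\pi(i_{d+1})>\pi(i_1)$. A partition $\lambda=(\lambda_1\ge\lambda_2\ge\cdots)$ is a finite weakly decreasing sequence of positive integers, with the convention $\lambda_i=0$ for $i$ beyond its length $\ell(\lambda)$; $|\lambda|=\sum_i\lambda_i$. A $d$-partition is a partition with $\ell(\lambda)\le d$. For $d$-partitions $\alpha,\beta$ write $\alpha\prec_{(d,L)}\beta$ if $\beta_1\ge\alpha_1\ge\beta_2\ge\alpha_2\ge\cdots\ge\beta_d\ge\alpha_d\ge\beta_1-L$. A $(d,L)$-cylindric standard Young tableau of size $n$ is a sequence of $d$-partitions $\emptyset=\lambda^{(0)}\prec_{(d,L)}\lambda^{(1)}\prec_{(d,L)}\cdots\prec_{(d,L)}\lambda^{(n)}$ with $|\lambda^{(i)}|-|\lambda^{(i-1)}|=1$ for all $i$;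 its shape is $\mathrm{sh}(T)=\lambda^{(n)}$. *)

(* Defs.v *)
From mathcomp Require Import all_boot all_order all_fingroup.
Set Implicit Arguments. Unset Strict Implicit. Unset Printing Implicit Defensive.

Definition contains_inc (n L : nat) (pi : 'S_n) : Prop :=
  exists s : seq 'I_n,
    [/\ size s = L.+1, sorted ltn (map val s)
      & sorted ltn (map (fun i => val (pi i)) s)].

(* pi contains d...1(d+1): indices i_1 < ... < i_{d+1} (here the sequence
   i :: s with size s = d) with pi(i_1) > ... > pi(i_d) and
   pi(i_{d+1}) > pi(i_1). *)
Definition contains_dec_then_big (n d : nat) (pi : 'S_n) : Prop :=
  exists (i : 'I_n) (s : seq 'I_n),
    [/\ size s = d, sorted ltn (map val (i :: s)),
        sorted gtn (map (fun j => val (pi j)) (take d (i :: s)))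
      & (val (pi i) < val (pi (last i s)))%N].

Definition avoids_both (n d L : nat) (pi : 'S_n) : Prop :=
  ~ contains_dec_then_big d pi /\ ~ contains_inc L pi.

(* A d-partition (length <= d) is represented by the list of its first d
   parts, padded with zeros: a weakly decreasing list of nats of size d. *)
Definition dpart (d : nat) (l : seq nat) : bool :=
  (size l == d) && sorted geq l.

Definition psize (l : seq nat) : nat := sumn l.

(* alpha <_{(d,L)} beta :
   beta_1 >= alpha_1 >= beta_2 >= alpha_2 >= ... >= beta_d >= alpha_d >= beta_1 - L
   (indices 0-based below; the last inequality over integers is
   alpha_d + L >= beta_1). *)
Definition cprec (d L : nat) (a b : seq nat) : bool :=
  [&& dpart d a, dpart d b,
      all (fun i => nth 0 b i >= nth 0 a i) (iota 0 d),
      all (fun i => nth 0 a i >= nth 0 b i.+1) (iota 0 d.-1)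
    & nth 0 b 0 <= nth 0 a d.-1 + L].

Definition cylSYT (d L n : nat) (T : seq (seq nat)) : Prop :=
  [/\ size T = n.+1,
      nth [::] T 0 = nseq d 0
    & forall i, (i < n)%N ->
        cprec d L (nth [::] T i) (nth [::] T i.+1) /\
        psize (nth [::] T i.+1) = (psize (nth [::] T i)).+1].

Definition cyl_shape (T : seq (seq nat)) : seq nat := last [::] T.

(* Main.v *)
(* Fomin growth diagrams: a permutation matrix, its cells indexed by (position,
   value), determines shapes at the grid vertices through a local rule, and the
   top and right sides of the grid carry the two tableaux. The rule is that of
   Robinson-Schensted with rows taken cyclically: a box bumped out of row [d]
   reenters in row 1. To recover the permutation one has to distinguish such a box
   from the one created by a point of the permutation; if points only occur where
   the shape to their SW has an empty row [d], then the rule is reversible.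
   Reading the rule backwards from a pair of tableaux always succeeds. Forwards,
   the empty row [d] and the width bound at a point hold exactly when the
   permutation avoids both patterns: by Viennot's shadow lines, row [d] at a vertex
   is nonempty iff there is a decreasing sequence of length [d] to the SW, and as
   long as row [d] is empty row 1 counts the longest increasing sequence.
   The rule is symmetric in the two axes, so inversion exchanges the tableaux. *)
Require Import Defs.
From mathcomp Require Import all_boot all_order all_fingroup.
From mathcomp Require Import zify.

Set Implicit Arguments. Unset Strict Implicit. Unset Printing Implicit Defensive.

(** * Shadow lines of a partial permutation matrix *)

Definition tr (T : Type) (f : nat -> nat -> T) : nat -> nat -> T := fun i j => f j i.

(* Points are (column, row) pairs, so [se] chains are the decreasing sequences. *)
Definition se : rel (nat * nat) := fun p q => (p.1 < q.1) && (q.2 < p.2).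
Definition ne : rel (nat * nat) := fun p q => (p.1 < q.1) && (p.2 < q.2).

Definition marked_in (M : nat -> nat -> bool) a b (p : nat * nat) :=
  [&& p.1 < a, p.2 < b & M p.1 p.2].

Definition chain (r : rel (nat * nat)) M a b k :=
  exists s, [/\ size s = k, sorted r s & all (marked_in M a b) s].

(* [f] counts the shadow lines of the point set [M] that pass weakly below and
   to the left of a grid vertex. *)
Record shadow_height (f : nat -> nat -> nat) (M : nat -> nat -> bool) a b : Prop :=
  ShadowHeight {
    height0l : forall j, j <= b -> f 0 j = 0;
    height0r : forall i, i <= a -> f i 0 = 0;
    height_step1 : forall i j, i < a -> j <= b -> f i j <= f i.+1 j <= (f i j).+1;
    height_step2 : forall i j, i <= a -> j < b -> f i j <= f i j.+1 <= (f i j).+1;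
    height_mark : forall i j, i < a -> j < b -> M i j ->
      [/\ f i.+1 j = f i j, f i j.+1 = f i j & f i.+1 j.+1 = (f i j).+1];
    height_nomark : forall i j, i < a -> j < b -> ~~ M i j ->
      f i.+1 j.+1 = maxn (f i.+1 j) (f i j.+1) }.

(* The outer corners of the shadow lines. *)
Definition corner (f : nat -> nat -> nat) i j :=
  (f i.+1 j == (f i j).+1) && (f i j.+1 == (f i j).+1).

Lemma se_trans : transitive se.
Proof. by move=> y x z; rewrite /se; lia. Qed.

Lemma ne_trans : transitive ne.
Proof. by move=> y x z; rewrite /ne; lia. Qed.

Lemma chainS r M a b a' b' k : a <= a' -> b <= b' -> chain r M a b k -> chain r M a' b' k.
Proof.
move=> leaa lebb [s [sz so al]]; exists s; split=> //.
by apply: sub_all al => p; rewrite /marked_in; case/and3P=> h1 h2 ->; lia.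
Qed.

Lemma chain1 r M a b : chain r M a b 1 <-> exists i j, [/\ i < a, j < b & M i j].
Proof.
split=> [[[|p [|q s]] [//= _ _]]|[i [j [ia jb Mij]]]].
  by rewrite /marked_in andbT => /and3P[pa pb Mp]; exists p.1, p.2.
by exists [:: (i, j)]; split; rewrite //= /marked_in /= ia jb Mij.
Qed.

Lemma shadow_tr f M a b : shadow_height f M a b -> shadow_height (tr f) (tr M) b a.
Proof.
case=> h1 h2 h3 h4 h5 h6; split; rewrite /tr.
- exact: h2.
- exact: h1.
- by move=> i j ib ja; apply: h4.
- by move=> i j ib ja; apply: h3.
- by move=> i j ib ja /h5 []//.
- by move=> i j ib ja /h6 -> //; rewrite maxnC.
Qed.

Section Shadow.
Variables (f : nat -> nat -> nat) (M : nat -> nat -> bool) (a b : nat).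
Hypothesis fM : shadow_height f M a b.

Lemma height_mono i j i' j' : i <= i' -> j <= j' -> i' <= a -> j' <= b -> f i j <= f i' j'.
Proof.
move=> + + + jb; elim: i' => [|i' IH] ii jj ia.
  have -> : i = 0 by lia.
  by rewrite !(height0l fM) //; lia.
case: (ltngtP i i'.+1) ii => // [ltii _|-> _].
  have := height_step1 fM (i := i') (j := j') ia jb.
  by have := IH ltii jj (ltnW ia); lia.
elim: j' jb jj {IH} => [|j' IHj] jb jj; first by have -> : j = 0 by lia.
case: (ltngtP j j'.+1) jj => // [ltjj _|-> //].
have := IHj (ltnW jb) ltjj.
by have := height_step2 fM (i := i'.+1) (j := j') ia jb; lia.
Qed.

(* Following a shadow line to the left from a point where it crosses row [j]. *)
Lemma mark_left i j : i <= a -> j < b -> f i j.+1 = (f i j).+1 ->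
  exists c, [/\ c < i, M c j & forall x, c < x <= i -> f x j.+1 = (f x j).+1].
Proof.
move=> + jb; elim: i => [|i IH] ia fij.
  by move: fij; rewrite !(height0l fM) //; lia.
have [Mij|nM] := boolP (M i j).
  by exists i; split=> // x ix; have -> : x = i.+1 by lia.
(* Without a mark the maximum is attained at [f i j.+1], so the line already crosses row [j] at
   abscissa [i]. *)
have e := height_nomark fM ia jb nM.
have h1 := height_step1 fM ia (ltnW jb).
have h2 := height_step2 fM (ltnW ia) jb.
have [|c [ci Mc hc]] := IH (ltnW ia); first by lia.
exists c; split=> [||x cx]; rewrite ?(leq_trans ci) //.
by have [->|nx] := eqVneq x i.+1; [|apply: hc; lia].
Qed.

(** An unmarked cell adds nothing to the two smaller rectangles, and a mark extends any chain to its
    SW. Conversely, the last point of a chain raises the height above that at its SW corner. *)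
Lemma height_chain i j l : i <= a -> j <= b -> l <= f i j <-> chain ne M i j l.
Proof.
move=> ia jb; split.
  elim: i j l ia jb => [|i IHi] j l ia jb lf.
    by exists [::]; split=> //=; move: lf; rewrite (height0l fM) //; lia.
  elim: j l jb lf => [|j IHj] l jb lf.
    by exists [::]; split=> //=; move: lf; rewrite (height0r fM) //; lia.
  have [Mij|nM] := boolP (M i j).
    case: l lf => [|l] lf; first by exists [::].
    have [_ _ e] := height_mark fM ia jb Mij.
    have [|s [sz so al]] := IHi j l (ltnW ia) (ltnW jb); first by lia.
    exists (rcons s (i, j)); split; first by rewrite size_rcons sz.
      move: so; rewrite !(sorted_pairwise ne_trans) pairwise_rcons => ->; rewrite andbT.
      by apply: sub_all al => p; rewrite /marked_in /ne /=; lia.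
    rewrite all_rcons {1}/marked_in /= Mij !ltnSn /=.
    by apply: sub_all al => p; rewrite /marked_in; case/and3P=> h1 h2 ->; lia.
  have e := height_nomark fM ia jb nM; move: lf; rewrite e leq_max => /orP[] lf.
    by apply: chainS (IHj _ (ltnW jb) lf); lia.
  by apply: chainS (IHi _ _ (ltnW ia) jb lf); lia.
case=> s; elim/last_ind: s i j l ia jb => [|s [x y] IH] i j l ia jb [<- so al] //.
move: so al; rewrite size_rcons !(sorted_pairwise ne_trans) pairwise_rcons all_rcons.
move=> /andP[le so] /andP[/and3P[/= xi yj Mxy] al].
have := IH x y (size s) (ltnW (leq_trans xi ia)) (ltnW (leq_trans yj jb)).
have xa := leq_trans xi ia; have yb := leq_trans yj jb.
have [_ _ e] := height_mark fM xa yb Mxy.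
have m := height_mono xi yj ia jb.
suff h : [/\ size s = size s, sorted ne s & all (marked_in M x y) s] by move/(_ h); lia.
split=> //; first by rewrite (sorted_pairwise ne_trans).
apply/allP=> p ps; have := allP le p ps; have := allP al p ps.
by rewrite /marked_in /ne /=; case/and3P=> _ _ ->; lia.
Qed.

(* Without a corner in the rectangle between [p] and [q], the shadow line of [p]
   would run right along its top row and that of [q] up its last column; the cell
   where they meet is a corner. *)
Lemma corner_between p q : marked_in M a b p -> marked_in M a b q -> se p q ->
  exists r, [/\ marked_in (corner f) a b r, p.1 < r.1 <= q.1 & q.2 < r.2 <= p.2].
Proof.
case: p q => [c r] [c' r'] /and3P[/= ca rb Mp] /and3P[/= ca' rb' Mq] /andP[/= cc rr].
have [/existsP[x /existsP[y /andP[/andP[xc yr] C]]]|nC] :=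
  boolP [exists x : 'I_a, exists y : 'I_b,
           (c < x <= c') && (r' < y <= r) && corner f x y].
  by exists (val x, val y); split=> //; rewrite /marked_in /= !ltn_ord C.
have {}nC x y : c < x <= c' -> r' < y <= r -> ~~ corner f x y.
  move=> xc yr; apply: contra nC => C.
  have xa : x < a by lia. have yb : y < b by lia.
  apply/existsP; exists (Ordinal xa); apply/existsP; exists (Ordinal yb) => /=.
  by rewrite C xc yr.
have [p1 p2 p3] := height_mark fM ca rb Mp.
have [q1 q2 q3] := height_mark fM ca' rb' Mq.
have H x : c < x <= c'.+1 -> f x r.+1 = (f x r).+1.
  elim: x => // x IH cx; have [->|nxc] := eqVneq x c; first by lia.
  have {IH} e := IH ltac:(lia).
  have xa : x < a by lia.
  have nM : ~~ M x r.
    by apply/negP=> /(height_mark fM xa rb)[]; lia.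
  have := height_nomark fM xa rb nM; have := nC x r ltac:(lia) ltac:(lia).
  have := height_step1 fM xa (ltnW rb).
  by rewrite /corner; lia.
have V y : r' < y <= r.+1 -> f c'.+1 y = (f c' y).+1.
  elim: y => // y IH cy; have [->|nyr] := eqVneq y r'; first by lia.
  have {IH} e := IH ltac:(lia).
  have yb : y < b by lia.
  have nM : ~~ M c' y.
    by apply/negP=> /(height_mark fM ca' yb)[]; lia.
  have := height_nomark fM ca' yb nM; have := nC c' y ltac:(lia) ltac:(lia).
  have := height_step2 fM (ltnW ca') yb.
  by rewrite /corner; lia.
by have := nC c' r ltac:(lia) ltac:(lia); rewrite /corner (H c') ?(V r) //; lia.
Qed.

(** Corners between consecutive marks form a chain because the ranges given by [corner_between] are
    disjoint. *)
Lemma chain_corner k : chain se M a b k.+1 -> chain se (corner f) a b k.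
Proof.
case=> [[|p s] [//= [<-] so /andP[Mp Ms]]].
suff [s' [sz so' al]] : exists s', [/\ size s' = size s, sorted se s' &
    all (fun r => [&& marked_in (corner f) a b r, p.1 < r.1 & r.2 <= p.2]) s'].
  by exists s'; split=> //; apply: sub_all al => r /and3P[].
elim: s p Mp so Ms => [|q s IH] p Mp /=; first by exists [::].
move=> /andP[pq so] /andP[Mq Ms].
have [r [Cr r1 r2]] := corner_between Mp Mq pq.
have [s' [sz so' al]] := IH q Mq so Ms.
move: (pq); rewrite /se => /andP[pq1 pq2].
exists (r :: s'); split; rewrite /= ?sz //.
  rewrite (path_sortedE se_trans) so' andbT.
  by apply: sub_all al => t /and3P[_]; rewrite /se; lia.
rewrite Cr; apply/andP; split; first by lia.
by apply: sub_all al => t /and3P[-> t1 t2]; lia.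
Qed.
End Shadow.

Lemma mark_below f M a b i j : shadow_height f M a b ->
  i < a -> j <= b -> f i.+1 j = (f i j).+1 ->
  exists c, [/\ c < j, M i c & forall y, c < y <= j -> f i.+1 y = (f i y).+1].
Proof. by move=> fM ia jb; apply: (mark_left (shadow_tr fM)). Qed.

(* Each corner has a mark to its left in its row and one below it in its column;
   alternating between the two while walking along a chain of corners gains one. *)
Lemma corner_chain f M a b k : shadow_height f M a b -> 0 < k ->
  chain se (corner f) a b k -> chain se M a b k.+1.
Proof.
move=> fM k0 [[|q s] [sz so al]]; first by rewrite -sz in k0.
move: sz so al => /= {k0} sz so /andP[Cq Cs].
have [/= qa qb /andP[/eqP q1 /eqP q2]] := and3P Cq.
have [c [cq Mc _]] := mark_left fM (ltnW qa) qb q2.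
suff [s' [sz' so' al]] : exists s', [/\ size s' = (size s).+1, path se (c, q.2) s' &
    all (marked_in M a b) s'].
  exists ((c, q.2) :: s'); split; rewrite //= ?sz' ?sz //.
  by rewrite al {1}/marked_in /= qb Mc; lia.
have: (c, q.2).1 < q.1 /\ q.2 <= (c, q.2).2 by [].
move: (c, q.2) => p; clear c cq Mc sz q1 q2 qa qb.
elim: s q p Cq so Cs => [|q' s IH] q p Cq /= so Cs [pq1 pq2].
all: have [/= qa qb /andP[/eqP q1 /eqP q2]] := and3P Cq.
all: have [d [dq Md hd]] := mark_below fM qa (ltnW qb) q1.
  exists [:: (q.1, d)]; split; rewrite //= /marked_in /se /= ?Md; lia.
move: so Cs => /andP[/andP[qq1 qq2] so] /andP[Cq' Cs].
have [/= qa' qb' /andP[/eqP q1' /eqP q2']] := and3P Cq'.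
(* The next point is the mark below [q] unless it lies below the row of [q']; then it is the mark
   left of [q']. *)
have [dq'|q'd] := leqP q'.2 d.
  have [|s' [sz' so' al]] := IH q' (q.1, d) Cq' so Cs; first by [].
  exists ((q.1, d) :: s'); split; rewrite //= ?sz' //.
    by rewrite so' /se /=; lia.
  by rewrite al /marked_in /= Md; lia.
have [c [cq' Mc hc]] := mark_left fM (ltnW qa') qb' q2'.
(* Otherwise a horizontal and a vertical shadow line would cross in the cell [(q.1, q'.2)], which
   the height rules forbid with or without a mark. *)
have qc : q.1 <= c.
  rewrite leqNgt; apply/negP=> cq.
  have e1 := hc q.1 ltac:(lia); have e2 := hc q.1.+1 ltac:(lia).
  have e3 := hd q'.2 ltac:(lia); have e4 := hd q'.2.+1 ltac:(lia).
  have [M1|nM] := boolP (M q.1 q'.2).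
    by have [] := height_mark fM qa qb' M1; lia.
  by have := height_nomark fM qa qb' nM; lia.
have [|s' [sz' so' al]] := IH q' (c, q'.2) Cq' so Cs; first by [].
exists ((c, q'.2) :: s'); split; rewrite //= ?sz' //.
  by rewrite so' /se /=; lia.
by rewrite al /marked_in /= Mc; lia.
Qed.

(** * The cyclic local rule *)

(** [F] takes the values at the SW, SE and NW corners of a cell. The same recursion serves forwards
    from empty sides and backwards from two tableaux; the corner value comes from [bl]. *)
Fixpoint grid (T : Type) (bl bb : nat -> T) (F : nat -> nat -> T -> T -> T -> T)
    (i : nat) : nat -> T :=
  if i is i'.+1 then
    let g := grid bl bb F i' in
    fix next j := if j is j'.+1 then F i' j' (g j') (next j') (g j'.+1) else bb i
  else bl.

Definition sadd (l : seq nat) (o : option nat) := if o is Some r then incr_nth l r else l.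

Lemma nth_sadd l o k : nth 0 (sadd l o) k = (o == Some k) + nth 0 l k.
Proof. by case: o => [r|] //=; rewrite nth_incr_nth. Qed.

Section Growth.
Variables d L : nat.
Hypotheses (hd : 0 < d) (hL : 0 < L).

Definition is_row (o : option nat) := if o is Some r then r < d else true.

Definition shape0 := nseq d 0.

(** Cylindric shapes: repeated with period [d] and shift [L], the rows remain weakly decreasing. *)
Definition valid (l : seq nat) :=
  [/\ size l = d, forall k, k.+1 < d -> nth 0 l k.+1 <= nth 0 l k
    & nth 0 l 0 <= nth 0 l d.-1 + L].

(* [cell x l m u r]: the shapes [l], [m], [u], [r] may sit at the SW, SE, NW, NE
   corners of a cell containing a point iff [x]. It is Fomin's local rule for
   Robinson-Schensted, except that a box bumped out of the last row reenters
   in the first one, and that a point may only occur while the last row is empty;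
   the latter makes the rule reversible. *)
Variant cell : bool -> seq nat -> seq nat -> seq nat -> seq nat -> Prop :=
| CellJoin l o o' of is_row o & is_row o' & o != o' :
    cell false l (sadd l o) (sadd l o') (sadd (sadd l o) o')
| CellConst l : cell false l l l l
| CellPoint l of nth 0 l d.-1 = 0 : cell true l l l (incr_nth l 0)
| CellBump l r of r < d :
    cell false l (incr_nth l r) (incr_nth l r) (incr_nth (incr_nth l r) (r.+1 %% d)).

Record growth (X : nat -> nat -> bool) (G : nat -> nat -> seq nat) a b : Prop := Growth {
  growth0l : forall j, j <= b -> G 0 j = shape0;
  growth0r : forall i, i <= a -> G i 0 = shape0;
  growth_cell : forall i j, i < a -> j < b ->
    cell (X i j) (G i j) (G i.+1 j) (G i j.+1) (G i.+1 j.+1) }.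

Lemma incr_nthC l r s : incr_nth (incr_nth l r) s = incr_nth (incr_nth l s) r.
Proof.
apply: (@eq_from_nth _ 0) => [|k _]; last by rewrite !nth_incr_nth addnCA.
have sz v i : size (incr_nth v i) = maxn (size v) i.+1 by rewrite size_incr_nth; case: ltnP; lia.
by rewrite !sz maxnAC.
Qed.

Lemma saddC l o o' : sadd (sadd l o) o' = sadd (sadd l o') o.
Proof. by case: o o' => [r|] [s|] //=; apply: incr_nthC. Qed.

Lemma size_sadd l o : is_row o -> size l = d -> size (sadd l o) = d.
Proof. by case: o => [r|] //= rd e; rewrite size_incr_nth e rd. Qed.

Lemma sadd_inj l o o' : is_row o -> is_row o' -> (sadd l o == sadd l o') = (o == o').
Proof.
have H o1 o2 : sadd l o1 = sadd l o2 -> o1 = o2.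
  case: o1 => [r|]; case: o2 => [s|] //= e; first congr Some.
  - by have /= := congr1 (nth 0 ^~ r) e; rewrite !nth_incr_nth; lia.
  - by have /= := congr1 (nth 0 ^~ r) e; rewrite !nth_incr_nth; lia.
  - by have /= := congr1 (nth 0 ^~ s) e; rewrite !nth_incr_nth; lia.
by move=> _ _; apply/eqP/eqP => [/H|->].
Qed.

Lemma incr_neq l r : (incr_nth l r == l) = false.
Proof. by apply/eqP=> /(congr1 (nth 0 ^~ r)) /=; rewrite nth_incr_nth eqxx; lia. Qed.

Lemma cell_tr x l m u r : cell x l m u r -> cell x l u m r.
Proof.
case=> {x l m u r} [l o o' ho ho' ne|l|l e|l r rd]; try by constructor.
by rewrite saddC; constructor; rewrite // eq_sym.
Qed.

Lemma growth_tr X G a b : growth X G a b -> growth (tr X) (tr G) b a.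
Proof. by case=> h1 h2 h3; split=> // i j ib ja; apply/cell_tr/h3. Qed.

Lemma growthS X G a b a' b' : a' <= a -> b' <= b -> growth X G a b -> growth X G a' b'.
Proof.
move=> la lb [h1 h2 h3]; split=> [j jb|i ia|i j ia jb].
- by apply: h1; lia.
- by apply: h2; lia.
by apply: h3; lia.
Qed.

Lemma next_row r : r < d -> r.+1 %% d = if r.+1 == d then 0 else r.+1.
Proof. by move=> rd; case: eqP => [->|ne]; rewrite ?modnn ?modn_small //; lia. Qed.

Lemma next_row_lt r : r.+1 %% d < d.
Proof. by rewrite ltn_pmod. Qed.

Lemma cell_steps x l m u r : cell x l m u r ->
  exists o o' p p', [/\ is_row o, is_row o', is_row p & is_row p'] /\
    [/\ m = sadd l o, u = sadd l o', r = sadd u p & r = sadd m p'].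
Proof.
case=> {x l m u r} [l o o' ho ho' ne|l|l e|l r rd].
- by exists o, o', o, o'; split=> //; split=> //; apply: saddC.
- by exists None, None, None, None.
- by exists None, None, (Some 0), (Some 0).
have h := next_row_lt r.
by exists (Some r), (Some r), (Some (r.+1 %% d)), (Some (r.+1 %% d)).
Qed.

Lemma cell_top x l m u r : cell x l m u r -> (r != u) = x || (m != l).
Proof.
case=> {x l m u r} [l o o' ho ho' ne|l|l e|l r rd]; rewrite ?eqxx ?incr_neq //.
rewrite saddC; congr (~~ _).
by rewrite -[X in _ == X]/(sadd _ None) -[X in _ = (_ == X)]/(sadd _ None) !sadd_inj.
Qed.

Lemma growth_step X G a b i j : growth X G a b -> i < a -> j <= b ->
  exists2 o, is_row o & G i.+1 j = sadd (G i j) o.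
Proof.
case=> _ h0 hc ia; case: j => [|j] jb; first by exists None; rewrite ?h0 //= ltnW.
have [o [o' [p [p' [[_ _ hp _] [_ _ e _]]]]]] := cell_steps (hc i j ia jb).
by exists p.
Qed.

(** By [cell_top] a box on a horizontal edge is passed on upwards, and new ones start only at
    points. *)
Lemma growth_edge X G a b i j : growth X G a b -> i < a -> j <= b ->
  (G i.+1 j != G i j) = has (X i) (iota 0 j).
Proof.
move=> gr ia; elim: j => [|j IH] jb.
  by rewrite !(growth0r gr) ?eqxx // ltnW.
rewrite (cell_top (growth_cell gr ia jb)) IH 1?ltnW // -addn1 iotaD has_cat /=.
by rewrite orbF orbC.
Qed.

(** * Rows of a growth diagram as shadow heights *)

Section RowHeights.
Variables (X : nat -> nat -> bool) (G : nat -> nat -> seq nat).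

Definition row k i j := nth 0 (G i j) k.

(** Viennot's iteration: the corners of one row are the points of the next. At index [d] they are
    the cells where a box leaves the last row. *)
Definition mark k := if k is k'.+1 then corner (row k') else X.

Lemma row_step a b k i j : growth X G a b -> i < a -> j <= b ->
  row k i j <= row k i.+1 j <= (row k i j).+1.
Proof.
move=> gr ia jb; rewrite /row.
by have [o _ ->] := growth_step gr ia jb; rewrite nth_sadd; lia.
Qed.

Definition no_wrap a b := forall i j, i < a -> j < b -> ~~ mark d i j.

(** Row [k] gains a new box exactly when one is bumped out of the row above, or at a point if
    [k = 0]. Only a box reentering row 0 would break this. *)
Lemma row_shadow a b k : growth X G a b -> no_wrap a b -> k < d ->
  shadow_height (row k) (mark k) a b.
Proof.
move=> gr nw kd; split=> [j jb|i ia|i j ia jb|i j ia jb|i j ia jb|i j ia jb].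
- by rewrite /row (growth0l gr) // nth_nseq; case: ifP.
- by rewrite /row (growth0r gr) // nth_nseq; case: ifP.
- exact: row_step gr ia jb.
- have [o _ e] := growth_step (growth_tr gr) jb ia.
  by rewrite /row; move: e; rewrite /tr => ->; rewrite nth_sadd; lia.
- have := growth_cell gr ia jb.
  case: k kd => [|k] kd /=.
    rewrite /row => + xx; rewrite xx.
    move E : true => x C; case: C E => // l _ _.
    by rewrite nth_incr_nth.
  rewrite /corner /row.
  case=> [l o o' ho ho' ne|l|l e|l r rd] /andP[/eqP h1 /eqP h2].
  + move: h1 h2 ne; rewrite !nth_sadd.
    by case: (o =P Some k) => [->|_]; case: (o' =P Some k) => [->|_]; rewrite ?eqxx //; lia.
  + lia.
  + lia.
  rewrite !nth_incr_nth next_row //; move: h1; rewrite !nth_incr_nth.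
  by case: (r.+1 =P d) => ? h1; split; lia.
have := growth_cell gr ia jb; have := nw i j ia jb.
case: k kd => [|k] kd /=; rewrite -(ltn_predK hd) /= /corner /row.
  move=> + + nX; rewrite (negbTE nX); move E : false => x wr C; case: C E wr => //.
  + move=> l o o' _ _ + _ _; rewrite !nth_sadd.
    by case: (o =P Some 0) => [->|_]; case: (o' =P Some 0) => [->|_]; rewrite ?eqxx //; lia.
  + by move=> *; rewrite maxnn.
  move=> l r rd _; rewrite !nth_incr_nth next_row //.
  by case: (r.+1 =P d); lia.
move=> _; case=> [l o o' ho ho' ne|l|l e|l r rd].
- move: ne; rewrite !nth_sadd => + _.
  by case: (o =P Some k.+1) => [->|_]; case: (o' =P Some k.+1) => [->|_]; rewrite ?eqxx //; lia.
- by rewrite maxnn.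
- by rewrite nth_incr_nth maxnn.
rewrite !nth_incr_nth next_row // maxnn.
by case: (r.+1 =P d); lia.
Qed.

Lemma row_mono a b k i j : growth X G a b -> i <= a -> j <= b -> row k i j <= row k a b.
Proof.
move=> gr ia jb; apply: (@leq_trans (row k a j)).
  elim: a ia gr => [|a IH] ia gr; first by have -> : i = 0 by lia.
  have [->//|nia] := eqVneq i a.+1.
  have := IH ltac:(lia) (growthS (leqnSn a) (leqnn b) gr).
  by have := row_step k gr (ltnSn a) jb; lia.
elim: b jb gr => [|b IH] jb gr; first by have -> : j = 0 by lia.
have [->//|njb] := eqVneq j b.+1.
have := IH ltac:(lia) (growthS (leqnn a) (leqnSn b) gr).
have [o _] := growth_step (growth_tr gr) (ltnSn b) (leqnn a).
by rewrite /row /tr => ->; rewrite nth_sadd; lia.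
Qed.

Lemma wrap_lastrow a b i j : growth X G a b -> i < a -> j < b -> mark d i j ->
  0 < row d.-1 i.+1 j.
Proof. by move=> gr ia jb; rewrite -(ltn_predK hd) /= /corner => /andP[/eqP->]. Qed.

(** Each passage to the next row shortens decreasing chains by exactly one, by [chain_corner] and
    [corner_chain]. *)
Lemma chain_mark a b k m : growth X G a b -> no_wrap a b -> k < d -> 0 < m ->
  chain se (mark k) a b m <-> chain se X a b (m + k).
Proof.
move=> gr nw; elim: k m => [|k IH] m kd m0; first by rewrite addn0.
rewrite addnS -addSn -(IH m.+1) 1?ltnW //.
have sh := row_shadow gr nw (ltnW kd).
by split; [apply: corner_chain sh m0 | apply: chain_corner sh _].
Qed.

Lemma no_wrapP a b : {i & {j | [/\ i < a, j < b & mark d i j]}} + {no_wrap a b}.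
Proof.
have [e|ne] := boolP [exists i : 'I_a, [exists j : 'I_b, mark d i j]].
  left; have /sigW[i /existsP/sigW[j m]] := existsP e.
  by exists (val i); exists (val j); rewrite !ltn_ord.
right=> i j ia jb; apply: contra ne => m.
by apply/existsP; exists (Ordinal ia); apply/existsP; exists (Ordinal jb).
Qed.

(* If boxes have wrapped around inside the rectangle, its subrectangles spanned by
   minimal vertices with nonempty last row are still free of wraps. *)
Lemma lastrow_chain a b : growth X G a b -> 0 < row d.-1 a b <-> chain se X a b d.
Proof.
have key a' b' : growth X G a' b' -> no_wrap a' b' ->
    0 < row d.-1 a' b' <-> chain se X a' b' d.
  move=> gr nw; have dd : d.-1 < d by lia.
  (* A positive height means a single mark, which is a chain for either order; this switches from
     [ne] to [se]. *)
  rewrite (height_chain (row_shadow gr nw dd)) // chain1.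
  rewrite -(chain1 se) (chain_mark gr nw dd) //.
  by rewrite add1n prednK.
move=> gr; split; last first.
  case: (no_wrapP a b) => [[i [j [ia jb m]]] _|nw]; last by move/(key _ _ gr nw).
  by have := wrap_lastrow gr ia jb m; have := row_mono d.-1 gr ia (ltnW jb); lia.
elim: {a b}_.+1 {-2}a {-2}b (ltnSn (a + b)) gr => // N IH a b abN gr pos.
case: (no_wrapP a b) => [[i [j [ia jb m]]]|nw]; last by apply/key.
(* The SE vertex of the wrapping cell has a smaller coordinate sum and a nonempty last row. *)
apply: (@chainS _ _ i.+1 j) => //; first exact: ltnW.
apply: IH (wrap_lastrow gr ia jb m); first by lia.
by apply: growthS gr; lia.
Qed.

(** By monotonicity an empty last row excludes wraps, and then row 0 is the shadow height of [X]
    itself. *)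
Lemma firstrow_chain a b l : growth X G a b -> row d.-1 a b = 0 ->
  l <= row 0 a b <-> chain ne X a b l.
Proof.
move=> gr z; case: (no_wrapP a b) => [[i [j [ia jb m]]]|nw].
  by have := wrap_lastrow gr ia jb m; have := row_mono d.-1 gr ia (ltnW jb); lia.
exact: (height_chain (row_shadow gr nw hd) l (leqnn a) (leqnn b)).
Qed.
End RowHeights.

(** * The local rule as a function in both directions *)

Definition decr (l : seq nat) r := mkseq (fun k => nth 0 l k - (r == k)) d.

(** The row of the box by which the shapes differ; equal shapes give the default [d]. *)
Definition diff (l m : seq nat) := find (fun k => nth 0 l k != nth 0 m k) (iota 0 d).

(** The fourth corner of a commuting square, with either the SW or the NE shape as [l]. *)
Definition midpoint (m u l : seq nat) :=
  mkseq (fun k => nth 0 m k + nth 0 u k - nth 0 l k) d.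

Definition fwd (x : bool) (l m u : seq nat) :=
  if m != u then midpoint m u l
  else if m == l then (if x then incr_nth l 0 else l)
  else incr_nth m ((diff l m).+1 %% d).

(** Only a box entering row 0 is ambiguous: if it was bumped, the last row of [m] is nonempty, while
    a point requires it empty. *)
Definition bwd (m u r : seq nat) :=
  if m != u then midpoint m u r
  else if r == m then m
  else if diff m r is k.+1 then decr m k
  else if 0 < nth 0 m d.-1 then decr m d.-1 else m.

Lemma diffE l r : r < d -> diff l (incr_nth l r) = r.
Proof.
move=> rd; set p := fun k => nth 0 l k != nth 0 (incr_nth l r) k.
have pE k : p k = (r == k) by rewrite /p nth_incr_nth; case: (r == k); lia.
have hp : has p (iota 0 d) by apply/hasP; exists r; rewrite ?mem_iota ?pE ?eqxx.
have := nth_find 0 hp; rewrite pE => /eqP {2}->.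
by rewrite nth_iota // -[X in _ < X](size_iota 0) -has_find.
Qed.

Lemma decrK l r : size l = d -> r < d -> decr (incr_nth l r) r = l.
Proof.
move=> sl rd; apply: (@eq_from_nth _ 0) => [|k]; rewrite size_mkseq // => kd.
by rewrite nth_mkseq // nth_incr_nth; lia.
Qed.

Lemma incrK m r : size m = d -> r < d -> 0 < nth 0 m r -> incr_nth (decr m r) r = m.
Proof.
move=> sl rd pos; apply: (@eq_from_nth _ 0) => [|k].
  by rewrite size_incr_nth size_mkseq rd.
rewrite size_incr_nth size_mkseq rd => kd.
by rewrite nth_incr_nth nth_mkseq //; case: (r =P k) => [<-|]; lia.
Qed.

Lemma sadd_cancel l m o : size l = size m -> sadd l o = sadd m o -> l = m.
Proof.
move=> e h; apply: (@eq_from_nth _ 0) => // k _.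
by have := congr1 (nth 0 ^~ k) h; rewrite /= !nth_sadd; lia.
Qed.

Lemma midpoint_join l o o' : size l = d ->
  midpoint (sadd l o) (sadd l o') (sadd (sadd l o) o') = l.
Proof.
move=> sl; apply: (@eq_from_nth _ 0) => [|k]; rewrite size_mkseq // => kd.
by rewrite nth_mkseq // !nth_sadd; lia.
Qed.

Lemma cell_fwd x l m u r : size l = d -> cell x l m u r -> r = fwd x l m u.
Proof.
move=> sl C; case: C sl => {x l m u r} [l o o' ho ho' ne|l|l e|l r rd] sl; rewrite /fwd.
- rewrite sadd_inj // ne.
  apply: (@eq_from_nth _ 0); first by rewrite size_mkseq !size_sadd.
  by move=> k; rewrite !size_sadd // => kd; rewrite nth_mkseq // !nth_sadd; lia.
- by rewrite !eqxx.
- by rewrite !eqxx.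
by rewrite eqxx incr_neq diffE.
Qed.

Lemma cell_bwd x l m u r : size l = d -> cell x l m u r -> l = bwd m u r.
Proof.
move=> sl C; case: C sl => {x l m u r} [l o o' ho ho' ne|l|l e|l r rd] sl; rewrite /bwd.
- by rewrite sadd_inj // ne midpoint_join.
- by rewrite !eqxx.
- by rewrite eqxx incr_neq diffE // e.
rewrite eqxx incr_neq diffE ?next_row_lt // next_row //.
case: (r.+1 =P d) => [rE|_]; last by rewrite decrK.
by rewrite -rE /= nth_incr_nth eqxx /= decrK.
Qed.

(** The shapes alone locate the points, which is how the permutation is read off a diagram. *)
Lemma cell_pointE x l m u r : cell x l m u r -> x = [&& l == m, l == u & r != l].
Proof.
case=> {x l m u r} [l o o' ho ho' ne|l|l e|l r rd].
- rewrite -[X in X == sadd l o]/(sadd l None) -[X in X == sadd l o']/(sadd l None).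
  by rewrite !sadd_inj //; case: o o' ne {ho ho'} => [?|] [?|].
- by rewrite eqxx.
- by rewrite eqxx incr_neq.
by rewrite eq_sym incr_neq.
Qed.

(** * Cylindric shapes under the local rule *)

Lemma row_excl (o o' : option nat) k : o != o' -> (o == Some k) + (o' == Some k) <= 1.
Proof. by case: (o =P Some k) => [->|_]; case: (o' =P Some k) => [->|_]; rewrite ?eqxx. Qed.

(** The smaller side of each cyclic row inequality gains at most one box, and the inequality already
    holds in the shape where it did. [valid_meet] is dual. *)
Lemma valid_join l o o' : is_row o -> is_row o' -> o != o' ->
  valid l -> valid (sadd l o) -> valid (sadd l o') -> valid (sadd (sadd l o) o').
Proof.
move=> ho ho' ne [l1 l2 l3] [m1 m2 m3] [u1 u2 u3].
split; first by rewrite !size_sadd.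
  move=> k kd; move: (l2 k kd) (m2 k kd) (u2 k kd) (row_excl k.+1 ne).
  by rewrite !nth_sadd; do 4?[case: (_ == Some _)] => /=; lia.
move: l3 m3 u3 (row_excl 0 ne); rewrite !nth_sadd.
by do 4?[case: (_ == Some _)] => /=; lia.
Qed.

Lemma valid_meet l o o' : is_row o -> is_row o' -> o != o' -> size l = d ->
  valid (sadd l o) -> valid (sadd l o') -> valid (sadd (sadd l o) o') -> valid l.
Proof.
move=> ho ho' ne l1 [m1 m2 m3] [u1 u2 u3] [r1 r2 r3]; split=> //.
  move=> k kd; move: (m2 k kd) (u2 k kd) (row_excl k ne).
  by rewrite !nth_sadd; do 4?[case: (_ == Some _)] => /=; lia.
move: m3 u3 (row_excl d.-1 ne); rewrite !nth_sadd.
by do 4?[case: (_ == Some _)] => /=; lia.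
Qed.

(** The bumped box enters the row cyclically following one that has just grown. *)
Lemma valid_bump l r : r < d -> valid l -> valid (incr_nth l r) ->
  valid (incr_nth (incr_nth l r) (r.+1 %% d)).
Proof.
move=> rd [l1 l2 l3] [m1 m2 m3]; split.
- by rewrite size_incr_nth m1 next_row_lt.
- move=> k kd; move: (l2 k kd) (m2 k kd); rewrite !nth_incr_nth next_row //.
  by case: (r.+1 =P d); lia.
move: l3 m3; rewrite !nth_incr_nth next_row //.
by case: (r.+1 =P d); lia.
Qed.

Lemma valid_unbump l r : r < d -> size l = d -> valid (incr_nth l r) ->
  valid (incr_nth (incr_nth l r) (r.+1 %% d)) -> valid l.
Proof.
move=> rd l1 [m1 m2 m3] [r1 r2 r3]; split=> //.
- move=> k kd; move: (r2 k kd) (m2 k kd); rewrite !nth_incr_nth next_row //.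
  by case: (r.+1 =P d); lia.
move: r3 m3; rewrite !nth_incr_nth next_row //.
by case: (r.+1 =P d); lia.
Qed.

(** At a point the empty last row is demanded by the rule, and [nth 0 l 0 < L] leaves room for the
    new box in row 0. *)
Lemma fwd_total (x : bool) l o o' : is_row o -> is_row o' ->
  valid l -> valid (sadd l o) -> valid (sadd l o') ->
  (x -> [/\ o = None, o' = None, nth 0 l d.-1 = 0 & nth 0 l 0 < L]) ->
  exists2 r, valid r & cell x l (sadd l o) (sadd l o') r.
Proof.
move=> ho ho' vl vm vu; case: x => [[]// -> -> z w|_].
  exists (incr_nth l 0); last by constructor.
  case: vl => l1 l2 l3; split; first by rewrite size_incr_nth l1 hd.
    by move=> k kd; rewrite !nth_incr_nth; have := l2 k kd; lia.
  by rewrite !nth_incr_nth eqxx; case: (0 =P d.-1) => [<-|]; lia.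
have [<-|ne] := eqVneq o o'; last first.
  by exists (sadd (sadd l o) o'); [apply: valid_join | constructor].
case: o ho vm {ho' vu} => [r|] rd vm; last by exists l => //; constructor.
by exists (incr_nth (incr_nth l r) (r.+1 %% d)); [apply: valid_bump | constructor].
Qed.

(** Different steps commute. Equal nontrivial steps undo a bump from the cyclically preceding row,
    or a point if that row is the last one and empty. *)
Lemma bwd_total m u r p p' : is_row p -> is_row p' -> valid m -> valid u -> valid r ->
  r = sadd m p -> r = sadd u p' -> exists x l, valid l /\ cell x l m u r.
Proof.
move=> hp hp' vm vu vr rm ru; have [m1 m2 m3] := vm; have [u1 u2 u3] := vu.
have rE k : (p == Some k) + nth 0 m k = (p' == Some k) + nth 0 u k.
  by rewrite -!nth_sadd -rm -ru.
have [e|ne] := eqVneq p p'.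
  subst p'; have {ru vu u1 u2 u3 rE} e : u = m.
    by apply: (@sadd_cancel _ _ p); rewrite ?u1 // -rm.
  case: p hp {hp'} rm => [s|] /= sd rm; last first.
    by exists false, m; split; rewrite // e rm; constructor.
  have [sz|s0] := eqVneq s 0.
    have [z|pos] := posnP (nth 0 m d.-1).
      by exists true, m; split; rewrite // e rm sz; constructor.
    have dd : d.-1 < d by lia.
    have mE := incrK m1 dd pos.
    have rE : r = incr_nth m (d.-1.+1 %% d) by rewrite rm sz prednK // modnn.
    exists false, (decr m d.-1); split; last first.
      by rewrite e rE -{2 3 4}mE; constructor.
    apply: (valid_unbump dd); rewrite ?size_mkseq // mE // -rE //.
  have s'd : s.-1 < d by lia.
  have sE : s.-1.+1 = s by rewrite prednK // lt0n.
  (* Row [s] of [r] holds the new box, so the row above, which is the same in [m], is nonempty. *)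
  have pos : 0 < nth 0 m s.-1.
    have [_ r2 _] := vr; have := r2 s.-1; rewrite sE => /(_ sd).
    by rewrite rm !nth_incr_nth; lia.
  have mE := incrK m1 s'd pos.
  have rE : r = incr_nth m (s.-1.+1 %% d) by rewrite rm sE modn_small.
  exists false, (decr m s.-1); split; last first.
    by rewrite e rE -{2 3 4}mE; constructor.
  by apply: (valid_unbump s'd); rewrite ?size_mkseq // mE // -rE.
(* The box added from [u] to [r] is the one that [m] has over [l]. *)
pose l := if p' is Some s then decr m s else m.
have l1 : size l = d by rewrite /l; case: (p') => [s|] //; rewrite size_mkseq.
have mE : m = sadd l p'.
  rewrite /l; case: p' hp' rE ne {ru l l1} => [s|] //= sd rE ne.
  rewrite incrK //; have := rE s; rewrite eqxx.
  by rewrite (negbTE ne); lia.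
have uE : u = sadd l p.
  apply: (@sadd_cancel _ _ p'); first by rewrite size_sadd // u1.
  by rewrite -ru rm mE saddC.
have ne' : p' != p by rewrite eq_sym.
exists false, l; rewrite rm uE mE; split; last by constructor.
by apply: (valid_meet hp' hp ne'); rewrite -?mE -?uE // -rm.
Qed.

(** * Growing forwards and backwards *)

Definition rs (X : nat -> nat -> bool) : nat -> nat -> seq nat :=
  grid (fun _ => shape0) (fun _ => shape0) (fun i j => fwd (X i j)).

Lemma growth_size X G a b i j : growth X G a b -> i <= a -> j <= b -> size (G i j) = d.
Proof.
move=> gr; elim: i => [|i IH] ia jb; first by rewrite (growth0l gr) // size_nseq.
have [o ho ->] := growth_step gr ia jb.
by rewrite size_sadd // IH // ltnW.
Qed.

Lemma growth_rs X G a b : growth X G a b ->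
  forall i j, i <= a -> j <= b -> G i j = rs X i j.
Proof.
move=> gr; elim=> [|i IHi] j ia jb; first by rewrite (growth0l gr).
elim: j jb => [|j IHj] jb; first by rewrite (growth0r gr).
have sz := growth_size gr (ltnW ia) (ltnW jb).
rewrite (cell_fwd sz (growth_cell gr ia jb)).
by rewrite IHi ?IHj ?IHi //; lia.
Qed.

(** [cell_bwd] propagates the equality of shapes from the NE corner, and [cell_pointE] transfers it
    to the points. *)
Lemma growth_bwd_inj n X1 X2 G1 G2 : growth X1 G1 n n -> growth X2 G2 n n ->
  (forall i, i <= n -> G1 i n = G2 i n) -> (forall j, j <= n -> G1 n j = G2 n j) ->
  forall i j, i < n -> j < n -> X1 i j = X2 i j.
Proof.
move=> gr1 gr2 top right.
have E i j : i <= n -> j <= n -> G1 (n - i) (n - j) = G2 (n - i) (n - j).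
  elim: i j => [|i IHi] j ile jle; first by rewrite subn0 right ?leq_subr.
  elim: j jle => [|j IHj] jle; first by rewrite subn0 top ?leq_subr.
  have ni : n - i.+1 < n by lia.
  have nj : n - j.+1 < n by lia.
  rewrite (cell_bwd (growth_size gr1 (ltnW ni) (ltnW nj)) (growth_cell gr1 ni nj)).
  rewrite (cell_bwd (growth_size gr2 (ltnW ni) (ltnW nj)) (growth_cell gr2 ni nj)).
  rewrite !subnSK //.
  by rewrite (IHj (ltnW jle)) (IHi j.+1) ?(IHi j) //; lia.
have {}E i j : i <= n -> j <= n -> G1 i j = G2 i j.
  by move=> ile jle; have := E _ _ (leq_subr i n) (leq_subr j n); rewrite !subKn.
move=> i j ile jle.
rewrite (cell_pointE (growth_cell gr1 ile jle)) (cell_pointE (growth_cell gr2 ile jle)).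
by rewrite !E // ltnW.
Qed.

(** A partial permutation matrix avoiding both patterns, each point being tested as the last entry
    of an occurrence. *)
Definition admissible (X : nat -> nat -> bool) :=
  [/\ forall i j, X i j -> ~ chain se X i j d /\ ~ chain ne X i j L,
      forall i j j', X i j -> X i j' -> j = j'
    & forall i i' j, X i j -> X i' j -> i = i'].

Lemma valid_shape0 : valid shape0.
Proof. by split=> [|k _|]; rewrite ?size_nseq // !nth_nseq; do !case: ifP. Qed.

Lemma rs_growth X a b : admissible X -> growth X (rs X) a b /\ valid (rs X a b).
Proof.
case=> ch ur uc.
elim: a b => [|a IHa] b.
  by split; [split=> // -[|?] | apply: valid_shape0].
elim: b => [|b IHb]; first by split; [split=> // -[|?] | apply: valid_shape0].
have [gr v] := IHa b; have [gu vu] := IHa b.+1; have [gm vm] := IHb.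
have [o ho eo] := growth_step gm (ltnSn a) (leqnn b).
have [o' ho' eo'] := growth_step (growth_tr gu) (ltnSn b) (leqnn a).
rewrite /tr in eo'.
(* At a point, the absence of others in its row and column makes both incoming steps trivial; the
   chain conditions bound the first and last rows. *)
have xc : X a b -> [/\ o = None, o' = None, nth 0 (rs X a b) d.-1 = 0
                     & nth 0 (rs X a b) 0 < L].
  move=> Xab; have [c1 c2] := ch _ _ Xab.
  have z : row (rs X) d.-1 a b = 0.
    by apply/eqP; rewrite -leqn0 leqNgt; apply/negP=> /(lastrow_chain gr).
  split=> //; last by rewrite ltnNge; apply/negP=> /(firstrow_chain _ gr z).
    have := growth_edge gm (ltnSn a) (leqnn b).
    rewrite eo; case: o ho {eo} => [r|] //= _; rewrite incr_neq => /esym/hasP[j].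
    by rewrite mem_iota => jb /(ur _ _ _ Xab); lia.
  have := growth_edge (growth_tr gu) (ltnSn b) (leqnn a); rewrite {1 2}/tr.
  rewrite eo'; case: o' ho' {eo'} => [r|] //= _; rewrite incr_neq => /esym/hasP[i].
  by rewrite mem_iota /tr => ia /(uc _ _ _ Xab); lia.
have [||r vr c] := fwd_total ho ho' v _ _ xc; rewrite -?eo -?eo' //.
have rE := cell_fwd (let: And3 h _ _ := v in h) c.
rewrite -eo -eo' in rE c.
have {}rE : r = rs X a.+1 b.+1 by [].
rewrite {}rE in vr c; split=> //.
split=> [[|j] _|[|i] _|i j ia jb] //.
have [ia'|ai] := ltnP i a; first exact: (growth_cell gu).
have [jb'|bj] := ltnP j b; first exact: (growth_cell gm).
by have [-> ->] : i = a /\ j = b by lia.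
Qed.

(** An earlier point in the column puts a box on the bottom edge of the later cell, but a cell with
    a point has no such box. *)
Lemma growth_unique X G n : growth X G n n -> forall i j j', i < n -> j < n -> j' < n ->
  X i j -> X i j' -> j = j'.
Proof.
move=> gr i j j' ia.
wlog jj : j j' / j < j'.
  move=> H jn jn' Xj Xj'; case: (ltngtP j j') => // h; first exact: (H j j').
  exact/esym/(H j' j).
move=> jn jn' Xj Xj'.
have := growth_edge gr ia (ltnW jn').
have /hasP -> : exists2 x, x \in iota 0 j' & X i x by exists j; rewrite // mem_iota.
have := cell_pointE (growth_cell gr ia jn').
by rewrite Xj' eq_sym => /esym/and3P[->].
Qed.

(** The rule empties the last row at a point, and the width bound at its NE corner bounds the first
    row; the chain lemmas translate both. *)
Lemma growth_admissible X G n : growth X G n n ->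
  (forall i j, i <= n -> j <= n -> valid (G i j)) ->
  (forall i j, X i j -> i < n /\ j < n) -> admissible X.
Proof.
move=> gr val bd; split.
- move=> i j Xij; have [ia jb] := bd _ _ Xij.
  have gr' := growthS (ltnW ia) (ltnW jb) gr.
  have [_ _ w] := val i.+1 j.+1 ia jb.
  have [z rE] : nth 0 (G i j) d.-1 = 0 /\ G i.+1 j.+1 = incr_nth (G i j) 0.
    by have := growth_cell gr ia jb; rewrite Xij; move E : true => x C; case: C E.
  split; first by move/(lastrow_chain gr'); rewrite /row z.
  move/(firstrow_chain _ gr' z); rewrite /row; move: w.
  (* For [d = 1] the first row is the last one, hence empty, and [0 < L] is used. *)
  by rewrite rE !nth_incr_nth z; case: (0 =P d.-1) => [e|]; rewrite -?e in z *; lia.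
- move=> i j j' X1 X2; have [ia ja] := bd _ _ X1; have [_ ja'] := bd _ _ X2.
  exact: (growth_unique gr ia).
move=> i i' j X1 X2; have [ia ja] := bd _ _ X1; have [ia' _] := bd _ _ X2.
exact: (growth_unique (growth_tr gr) ja).
Qed.

(** * The diagram recovered from two tableaux *)

Section Backward.
Variables (n : nat) (P Q : nat -> seq nat).
Hypotheses (vP : forall j, j <= n -> valid (P j)) (vQ : forall i, i <= n -> valid (Q i)).
Hypotheses (sP : forall j, j < n -> exists2 r, r < d & P j.+1 = incr_nth (P j) r).
Hypotheses (sQ : forall j, j < n -> exists2 r, r < d & Q j.+1 = incr_nth (Q j) r).
Hypotheses (PQn : P n = Q n) (P0 : P 0 = shape0) (Q0 : Q 0 = shape0).

(* Indexed by the distance from the NE corner. *)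
Let H := grid (fun j => P (n - j)) (fun i => Q (n - i)) (fun _ _ r u m => bwd m u r).

Let edge2 i j := exists2 o, is_row o & H i j = sadd (H i j.+1) o.
Let edge1 i j := exists2 o, is_row o & H i j = sadd (H i.+1 j) o.

Lemma back_cell i j : valid (H i j) -> valid (H i j.+1) -> valid (H i.+1 j) ->
  edge1 i j -> edge2 i j ->
  valid (H i.+1 j.+1) /\
  exists x, cell x (H i.+1 j.+1) (H i j.+1) (H i.+1 j) (H i j).
Proof.
move=> vr vm vu [p' hp' e'] [p hp e].
have [x [l [vl c]]] := bwd_total hp hp' vm vu vr e e'.
have lE : l = H i.+1 j.+1 by rewrite (cell_bwd (let: And3 h _ _ := vl in h) c).
by rewrite -lE; split=> //; exists x.
Qed.

Lemma back_row i : i < n ->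
  (forall j, j <= n -> valid (H i j)) /\ (forall j, j < n -> edge2 i j) ->
  forall j, j <= n -> valid (H i.+1 j) /\ edge1 i j.
Proof.
move=> ia [v e2]; elim=> [|j IH] jn.
  split; first by apply: vQ; apply: leq_subr.
  have [r rd e] := sQ (ltac:(lia) : n - i.+1 < n).
  exists (Some r) => //=; rewrite -[H i.+1 0]/(Q (n - i.+1)) -e subnSK //.
  (* The corner [H 0 0] is [P n], so the common shape of the tableaux enters here. *)
  by case: (i); rewrite /H /= ?subn0 ?PQn.
have [vj e1] := IH (ltnW jn).
have [vl [x c]] := back_cell (v _ (ltnW jn)) (v _ jn) vj e1 (e2 _ jn).
split=> //; have [o [o' [p [p' [[ho _ _ _] [e _ _ _]]]]]] := cell_steps c.
by exists o.
Qed.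

Lemma back_rows i : i <= n ->
  (forall j, j <= n -> valid (H i j)) /\ (forall j, j < n -> edge2 i j).
Proof.
elim: i => [|i IH] ia.
  split=> j jn; first by apply: vP; apply: leq_subr.
  have [r rd e] := sP (ltac:(lia) : n - j.+1 < n).
  by exists (Some r) => //=; rewrite /H /= -e subnSK.
have R := IH (ltnW ia); have B := back_row ia R; have [v e2] := R.
split=> j jn; first by have [] := B j jn.
have [vj e1] := B _ (ltnW jn).
have [vl [x c]] := back_cell (v _ (ltnW jn)) (v _ jn) vj e1 (e2 _ jn).
have [o [o' [p [p' [[_ ho _ _] [_ e _ _]]]]]] := cell_steps c.
by exists o'.
Qed.

Let G i j := H (n - i) (n - j).

(** The points dictated by [cell_pointE], cut off outside the grid. *)
Let X i j := [&& i < n, j < n, G i j == G i.+1 j, G i j == G i j.+1 &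
                G i.+1 j.+1 != G i j].

Lemma back_growth : exists X G, [/\ growth X G n n,
  forall i j, i <= n -> j <= n -> valid (G i j),
  forall i j, X i j -> i < n /\ j < n,
  forall j, j <= n -> G n j = P j & forall i, i <= n -> G i n = Q i].
Proof.
have GP j : j <= n -> G n j = P j by move=> jn; rewrite /G subnn /H /= subKn.
have GQ i : i <= n -> G i n = Q i.
  move=> ile; rewrite /G subnn -[in RHS](subKn ile); case: (n - i) => //=.
  by rewrite /H /= subn0 PQn.
have v i j : i <= n -> j <= n -> valid (G i j).
  by move=> ile jn; have [+ _] := back_rows (leq_subr i n); apply; apply: leq_subr.
have c i j : i < n -> j < n ->
    cell (X i j) (G i j) (G i.+1 j) (G i j.+1) (G i.+1 j.+1).
  move=> ia ja; have ni : n - i.+1 < n by lia.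
  have nj : n - j.+1 < n by lia.
  have R := back_rows (ltnW ni); have B := back_row ni R; have [vr e2] := R.
  have [vj e1] := B _ (ltnW nj).
  have [_ [x C]] := back_cell (vr _ (ltnW nj)) (vr _ nj) vj e1 (e2 _ nj).
  rewrite !subnSK // -!/(G _ _) in C.
  by rewrite /X ia ja /= -(cell_pointE C).
have zero s : valid s -> (forall k, nth 0 s k <= 0) -> s = shape0.
  case=> sz _ _ h; apply: (@eq_from_nth _ 0) => [|k]; rewrite ?size_nseq // => kd.
  by rewrite nth_nseq -?sz kd; have := h k; lia.
exists X, G; split=> //; last by move=> i j /and3P[].
(* The left and bottom sides are contained in their far ends [Q 0] and [P 0], which are empty. *)
split=> // [j jn|i ile]; apply: zero; try exact: v; move=> k.
  have {1}-> : j = n - (n - j) by rewrite subKn.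
  elim: (n - j) (leq_subr j n) => [|m IH] mn.
    by rewrite subn0 GQ // Q0 nth_nseq; case: ifP.
  apply: leq_trans (IH (ltnW mn)).
  have [n0 nm] : 0 < n /\ n - m.+1 < n by lia.
  have [o [o' [p [p' [_ [_ e _ _]]]]]] := cell_steps (c 0 (n - m.+1) n0 nm).
  by move: e; rewrite subnSK // => ->; rewrite nth_sadd leq_addl.
have {1}-> : i = n - (n - i) by rewrite subKn.
elim: (n - i) (leq_subr i n) => [|m IH] mn.
  by rewrite subn0 GP // P0 nth_nseq; case: ifP.
apply: leq_trans (IH (ltnW mn)).
have [n0 nm] : 0 < n /\ n - m.+1 < n by lia.
have [o [o' [p [p' [_ [e _ _ _]]]]]] := cell_steps (c (n - m.+1) 0 nm n0).
by move: e; rewrite subnSK // => ->; rewrite nth_sadd leq_addl.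
Qed.
End Backward.

(** * Tableaux and permutations *)

Lemma dpartP l : reflect (size l = d /\ forall k, k.+1 < d -> nth 0 l k.+1 <= nth 0 l k)
  (dpart d l).
Proof.
apply: (iffP andP) => [[/eqP sl /(sortedP 0) so]|[sl so]].
  by split=> // k kd; apply: so; rewrite sl.
by split; [apply/eqP | apply/(sortedP 0) => k; rewrite sl; apply: so].
Qed.

Lemma sumn_incr (a b : seq nat) : size a = size b ->
  (forall k, k < size a -> nth 0 a k <= nth 0 b k) -> sumn b = (sumn a).+1 ->
  exists2 r, r < size a & b = incr_nth a r.
Proof.
have eq_sum : forall s t : seq nat, size s = size t ->
    (forall k, k < size s -> nth 0 s k <= nth 0 t k) ->
    sumn s <= sumn t /\ (sumn t = sumn s -> t = s).
  elim=> [|x s IH] [|y t] //= [st] le.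
  have [l e] := IH t st (fun k => le k.+1); have := le 0 isT => /= xy.
  split=> [|E]; first lia.
  have exy : x = y by lia.
  by rewrite exy e //; lia.
elim: a b => [|x a IH] [|y b] //= [ab] le E.
have [l e] := eq_sum a b ab (fun k => le k.+1); have := le 0 isT => /= xy.
have [exy|nxy] := eqVneq x y.
  have [|r ra ->] := IH b ab (fun k => le k.+1); first by lia.
  by exists r.+1; rewrite //= exy.
have -> : b = a by apply: e; lia.
by exists 0; rewrite //=; congr cons; lia.
Qed.

Lemma sumn_incr_nth l r : sumn (incr_nth l r) = (sumn l).+1.
Proof.
elim: l r => [|x l IH] [|r] //=; last by rewrite IH addnS.
by elim: r.
Qed.

Lemma cprec_valid a b : cprec d L a b -> psize b = (psize a).+1 ->
  [/\ valid a, valid b & exists2 r, r < d & b = incr_nth a r].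
Proof.
case/and5P=> /dpartP[sa da] /dpartP[sb db] /allP ab _ w E.
have {}ab k : k < d -> nth 0 a k <= nth 0 b k by move=> kd; apply: ab; rewrite mem_iota.
split; [split=> // | split=> // |].
- by have := ab 0 hd; lia.
- by have := ab d.-1 ltac:(lia); lia.
rewrite -sa; apply: sumn_incr => //; first by rewrite sa.
by move=> k; rewrite sa; apply: ab.
Qed.

(** As only one row changes, comparing row [k] of [a] with row [k.+1] of the new shape amounts to an
    inequality within one of the two. *)
Lemma valid_cprec a r : r < d -> valid a -> valid (incr_nth a r) ->
  cprec d L a (incr_nth a r).
Proof.
move=> rd [sa da wa] [sb db wb].
apply/and5P; split; [exact/dpartP | exact/dpartP | | |].
- by apply/allP=> k _; rewrite nth_incr_nth leq_addl.
- apply/allP=> k; rewrite mem_iota => kd.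
  by have := da k ltac:(lia); have := db k ltac:(lia); rewrite !nth_incr_nth; lia.
by move: wb; rewrite !nth_incr_nth; case: (d.-1 =P 0) => [->|]; lia.
Qed.

Lemma cylSYTP n T : 0 < n -> cylSYT d L n T <->
  [/\ size T = n.+1, nth [::] T 0 = shape0,
      forall i, i <= n -> valid (nth [::] T i)
    & forall i, i < n ->
        exists2 r, r < d & nth [::] T i.+1 = incr_nth (nth [::] T i) r].
Proof.
move=> n0; split=> [[sT T0 TS]|[sT T0 vT TS]]; split=> //.
- case=> [|i] ile; first by rewrite T0; apply: valid_shape0.
  by have [c e] := TS i ile; have [] := cprec_valid c e.
- by move=> i ile; have [c e] := TS i ile; have [] := cprec_valid c e.
move=> i ile; have [r rd e] := TS i ile.
rewrite e /psize sumn_incr_nth; split=> //; apply: valid_cprec => //.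
  by apply: vT; apply: ltnW.
by rewrite -e; apply: vT.
Qed.

(** * Permutation matrices and pattern avoidance *)

Section Perm.
Variable n : nat.
Implicit Type pi : 'S_n.

Definition pmat pi i j := [exists k : 'I_n, (val k == i) && (val (pi k) == j)].

Lemma pmatP pi i j :
  reflect (exists k : 'I_n, i = val k /\ j = val (pi k)) (pmat pi i j).
Proof.
apply: (iffP existsP) => [[k /andP[/eqP <- /eqP <-]]|[k [-> ->]]]; exists k => //.
by rewrite !eqxx.
Qed.

Lemma pmat_ord pi (k : 'I_n) j : pmat pi k j = (val (pi k) == j).
Proof.
apply/pmatP/eqP => [[k' [/val_inj -> ->]] //|<-]; by exists k.
Qed.

Lemma pmatV pi i j : pmat pi^-1%g i j = pmat pi j i.
Proof.
apply/pmatP/pmatP => -[k [-> ->]].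
  by exists ((pi^-1)%g k); rewrite permKV.
by exists (pi k); rewrite permK.
Qed.

Definition point pi (k : 'I_n) := (val k, val (pi k)).

Lemma points_lift pi a b s : all (marked_in (pmat pi) a b) s ->
  exists t, s = map (point pi) t.
Proof.
elim: s => [|[i j] s IH] /=; first by exists [::].
case/andP=> /and3P[_ _ /pmatP[k [/= -> ->]]] /IH[t ->].
by exists (k :: t).
Qed.

Lemma chain_ne_perm pi (m : 'I_n) k :
  chain ne (pmat pi) m (pi m) k <->
  exists s : seq 'I_n, [/\ size s = k, sorted ltn (map val (rcons s m))
      & sorted ltn (map (fun i => val (pi i)) (rcons s m))].
Proof.
have srt s : sorted ne (map (point pi) s) = sorted ltn (map val s) &&
    sorted ltn (map (fun i => val (pi i)) s).
  by rewrite !sorted_map -sorted_relI.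
split=> [[s [sz so al]]|[s [sz so1 so2]]].
  have [t st] := points_lift al; exists t.
  have : sorted ne (map (point pi) (rcons t m)).
    rewrite map_rcons -st (sorted_pairwise ne_trans) pairwise_rcons.
    rewrite -(sorted_pairwise ne_trans) so andbT.
    by apply: sub_all al => p /and3P[h1 h2 _]; apply/andP.
  by rewrite srt => /andP[]; split=> //; rewrite -sz st size_map.
have: sorted ne (map (point pi) (rcons s m)) by rewrite srt so1.
rewrite map_rcons (sorted_pairwise ne_trans) pairwise_rcons => /andP[al so].
exists (map (point pi) s); split; rewrite ?size_map ?(sorted_pairwise ne_trans) //.
move: al; rewrite !all_map; apply: sub_all => i /andP[h1 h2].
by rewrite /= /marked_in h1 h2 pmat_ord eqxx.
Qed.

Lemma contains_incP pi :
  contains_inc L pi <-> exists m : 'I_n, chain ne (pmat pi) m (pi m) L.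
Proof.
split=> [[s]|[m /chain_ne_perm[s [sz so1 so2]]]].
  case/lastP: s => [[]//|s m [sz so1 so2]]; exists m; apply/chain_ne_perm.
  by exists s; split=> //; move: sz; rewrite size_rcons => -[].
by exists (rcons s m); rewrite size_rcons sz.
Qed.

(** The last entry exceeds the first, which is the largest of the decreasing ones, so all of these
    lie to its SW. *)
Lemma contains_decP pi :
  contains_dec_then_big d pi <-> exists m : 'I_n, chain se (pmat pi) m (pi m) d.
Proof.
have srt s : sorted se (map (point pi) s) = sorted ltn (map val s) &&
    sorted gtn (map (fun i => val (pi i)) s).
  by rewrite !sorted_map -sorted_relI.
(* [take d] drops just the last of the [d.+1] indices. *)
have tk i (s : seq 'I_n) m : size (rcons s m) = d -> take d (i :: rcons s m) = i :: s.
  by rewrite size_rcons => <- /=; rewrite -cats1 take_size_cat.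
split=> [[i [s]]|[m [[|p s] [sz so al]]]]; last 2 first.
- by move: sz hd => <-.
- have [t st] := points_lift al; case: t st => // i t [pE sE]; exists i, (rcons t m).
  have sz' : size (rcons t m) = d by rewrite size_rcons -sz sE /= size_map.
  move: so; rewrite pE sE -[_ :: map _ _]/(map (point pi) (i :: t)) srt => /andP[so1 so2].
  have al' : all (fun k : 'I_n => (k < m) && (pi k < pi m)) (i :: t).
    move: al; rewrite pE sE -[_ :: map _ _]/(map (point pi) (i :: t)) all_map.
    by apply: sub_all => k /and3P[h1 h2 _]; apply/andP.
  rewrite tk // last_rcons; split=> //; last by case/andP: al' => /andP[].
  rewrite -rcons_cons map_rcons (sorted_pairwise ltn_trans) pairwise_rcons.
  rewrite -(sorted_pairwise ltn_trans) so1 andbT all_map.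
  by apply: sub_all al' => k /andP[].
case/lastP: s => [[e]|s m []]; first by move: hd; rewrite -e.
move=> sz so1; rewrite (tk _ _ _ sz) last_rcons => so2 lt; exists m.
move: so1; rewrite -rcons_cons map_rcons (sorted_pairwise ltn_trans) pairwise_rcons.
rewrite -(sorted_pairwise ltn_trans) => /andP[al so1].
have gtn_trans : transitive gtn by move=> y x z /= h1 h2; apply: ltn_trans h2 h1.
have := so2; rewrite /= (path_sortedE gtn_trans) => /andP[/allP le _].
exists (map (point pi) (i :: s)); split.
- by rewrite size_map -sz size_rcons.
- by rewrite srt so1.
rewrite all_map; apply/allP=> k ks.
rewrite /= /marked_in /= pmat_ord eqxx andbT; apply/andP; split.
  by move: al; rewrite all_map => /allP/(_ k ks).
move: ks; rewrite inE => /predU1P[->//|/(map_f (fun x => val (pi x)))/le /= ki].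
exact: ltn_trans ki lt.
Qed.

Lemma avoids_admissible pi : avoids_both d L pi <-> admissible (pmat pi).
Proof.
split=> [[a1 a2]|[ch _ _]].
  split.
  - move=> i j /pmatP[k [-> ->]]; split=> c.
      by apply/a1/contains_decP; exists k.
    by apply/a2/contains_incP; exists k.
  - by move=> i j j' /pmatP[k [-> ->]] /pmatP[k' [/val_inj <- ->]].
  by move=> i i' j /pmatP[k [-> ->]] /pmatP[k' [-> /val_inj/perm_inj ->]].
have pm (m : 'I_n) : pmat pi m (pi m) by rewrite pmat_ord.
split=> [/contains_decP[m]|/contains_incP[m]]; by have [] := ch _ _ (pm m).
Qed.

Lemma pmat_inj pi1 pi2 :
  (forall i j, i < n -> j < n -> pmat pi1 i j = pmat pi2 i j) -> pi1 = pi2.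
Proof.
move=> e; apply/permP=> k; apply/val_inj/eqP.
by rewrite eq_sym -pmat_ord -e ?ltn_ord // pmat_ord.
Qed.

Lemma perm_of_matrix (X : nat -> nat -> bool) :
  (forall i, i < n -> has (X i) (iota 0 n)) ->
  (forall i j, X i j -> i < n /\ j < n) ->
  (forall i j j', X i j -> X i j' -> j = j') ->
  (forall i i' j, X i j -> X i' j -> i = i') ->
  exists pi, forall i j, X i j = pmat pi i j.
Proof.
move=> ex bd ur uc.
have ex' (i : 'I_n) : exists j : 'I_n, X i j.
  have /hasP[j] := ex i (ltn_ord i); rewrite mem_iota => /andP[_ jn] Xij.
  by exists (Ordinal jn).
pose f i := xchoose (ex' i).
have fX (i : 'I_n) : X i (f i) := xchooseP (ex' i).
have f_inj : injective f.
  by move=> i i' e; apply/val_inj/(uc _ _ (f i)); rewrite ?fX // e fX.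
exists (perm f_inj) => i j; apply/idP/pmatP => [Xij|[k [-> ->]]].
  have [ia _] := bd _ _ Xij; exists (Ordinal ia); split=> //.
  by rewrite permE; apply: ur Xij (fX (Ordinal ia)).
by rewrite permE fX.
Qed.

(** * The correspondence between permutations and pairs of tableaux *)

Definition cylindric_RS pi : seq (seq nat) * seq (seq nat) :=
  (mkseq (fun j => rs (pmat pi) n j) n.+1, mkseq (fun i => rs (pmat pi) i n) n.+1).

Lemma cyl_shape_mkseq (f : nat -> seq nat) : cyl_shape (mkseq f n.+1) = f n.
Proof. by rewrite /cyl_shape -nth_last size_mkseq nth_mkseq. Qed.

(** A point in every column makes every step along the top side add a box. *)
Lemma row_cylSYT X (f : nat -> seq nat) : 0 < n -> admissible X ->
  (forall i, i < n -> has (X i) (iota 0 n)) ->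
  (forall i, i <= n -> f i = rs X i n) -> cylSYT d L n (mkseq f n.+1).
Proof.
move=> n0 adm ex fE; apply/cylSYTP => //.
have [gr _] := rs_growth n n adm.
split; rewrite ?size_mkseq ?nth_mkseq ?fE //.
  by move=> i ile; rewrite nth_mkseq ?fE //; have [] := rs_growth i n adm.
move=> i ile; rewrite !nth_mkseq ?fE //; try lia.
have := growth_edge gr ile (leqnn n); rewrite ex //.
have [o ho ->] := growth_step gr ile (leqnn n).
by case: o ho => [r|] /= rd; rewrite ?eqxx // => _; exists r.
Qed.

Lemma pmat_row pi i : i < n -> has (pmat pi i) (iota 0 n).
Proof.
move=> ile; apply/hasP; exists (val (pi (Ordinal ile))); rewrite ?mem_iota //=.
by apply/pmatP; exists (Ordinal ile).
Qed.

(** The transposed diagram is a growth diagram for the inverse, and growth diagrams are unique. *)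
Lemma pmat_rsV pi i j : avoids_both d L pi -> i <= n -> j <= n ->
  rs (pmat pi^-1%g) i j = rs (pmat pi) j i.
Proof.
move=> /avoids_admissible /(rs_growth n n)[gr _] ile jle.
suff gr' : growth (pmat pi^-1%g) (tr (rs (pmat pi))) n n by rewrite -(growth_rs gr').
by case: (growth_tr gr) => h1 h2 h3; split=> // x y xn yn; rewrite pmatV; apply: h3.
Qed.

(** The transposed diagram has valid shapes, which [growth_admissible] turns back into avoidance. *)
Lemma avoids_inv pi : avoids_both d L pi -> avoids_both d L pi^-1%g.
Proof.
move=> av; have adm := (avoids_admissible pi).1 av; apply/avoids_admissible.
have [gr _] := rs_growth n n adm.
apply: (@growth_admissible _ (tr (rs (pmat pi))) n).
- by case: (growth_tr gr) => h1 h2 h3; split=> // x y xn yn; rewrite pmatV; apply: h3.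
- by move=> i j _ _; have [] := rs_growth j i adm.
by move=> i j /pmatP[k [-> ->]]; rewrite !ltn_ord.
Qed.

Lemma cylindric_RS_valid pi : 0 < n -> avoids_both d L pi ->
  [/\ cylSYT d L n (cylindric_RS pi).1, cylSYT d L n (cylindric_RS pi).2
    & cyl_shape (cylindric_RS pi).1 = cyl_shape (cylindric_RS pi).2].
Proof.
move=> n0 av; rewrite !cyl_shape_mkseq; split=> //.
  (* The right side of the diagram is the top side for the inverse. *)
  apply: row_cylSYT (pmat_row pi^-1%g) _ => //.
    exact/avoids_admissible/avoids_inv.
  by move=> j jle; rewrite pmat_rsV.
by apply: row_cylSYT (pmat_row pi) _ => //; apply/avoids_admissible.
Qed.

Lemma cylindric_RS_inj pi1 pi2 : avoids_both d L pi1 -> avoids_both d L pi2 ->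
  cylindric_RS pi1 = cylindric_RS pi2 -> pi1 = pi2.
Proof.
move=> /avoids_admissible/(rs_growth n n)[gr1 _] /avoids_admissible/(rs_growth n n)[gr2 _].
move=> e; apply: pmat_inj; apply: (growth_bwd_inj gr1 gr2) => k kn.
  by have := congr1 (fun s => nth [::] s.2 k) e; rewrite !nth_mkseq.
by have := congr1 (fun s => nth [::] s.1 k) e; rewrite !nth_mkseq.
Qed.

Lemma cylindric_RS_surj P Q : 0 < n -> cylSYT d L n P -> cylSYT d L n Q ->
  cyl_shape P = cyl_shape Q -> exists2 pi, avoids_both d L pi & cylindric_RS pi = (P, Q).
Proof.
move=> n0 /(cylSYTP _ n0)[sP P0 vP tP] /(cylSYTP _ n0)[sQ Q0 vQ tQ].
rewrite /cyl_shape -!nth_last sP sQ /= => PQn.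
have [X [G [gr v bd GP GQ]]] := back_growth vP vQ tP tQ PQn P0 Q0.
have [_ ur uc] := growth_admissible gr v bd.
(* Every step of [Q] adds a box, so by [growth_edge] every column contains a point. *)
have [|pi XE] := perm_of_matrix _ bd ur uc.
  move=> i ile; rewrite -(growth_edge gr ile (leqnn n)) !GQ ?(ltnW ile) //.
  by have [r _ ->] := tQ i ile; rewrite incr_neq.
have gr' : growth (pmat pi) G n n.
  by case: gr => h1 h2 h3; split=> // i j ia jb; rewrite -XE; apply: h3.
exists pi.
  apply/avoids_admissible/(growth_admissible gr' v) => i j.
  by rewrite -XE; apply: bd.
congr pair; apply: (@eq_from_nth _ [::]); rewrite size_mkseq ?sP ?sQ // => k kn.
  by rewrite nth_mkseq // -(growth_rs gr') ?GP.
by rewrite nth_mkseq // -(growth_rs gr') ?GQ.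
Qed.
End Perm.
End Growth.

Theorem theorem1p1 (n d L : nat) (hn : (0 < n)%N) (hd : (0 < d)%N) (hL : (0 < L)%N) :
  exists Phi : 'S_n -> seq (seq nat) * seq (seq nat),
    [/\ (forall pi, avoids_both d L pi ->
           [/\ cylSYT d L n (Phi pi).1, cylSYT d L n (Phi pi).2
             & cyl_shape (Phi pi).1 = cyl_shape (Phi pi).2]),
        (forall pi1 pi2, avoids_both d L pi1 -> avoids_both d L pi2 ->
           Phi pi1 = Phi pi2 -> pi1 = pi2),
        (forall P Q, cylSYT d L n P -> cylSYT d L n Q -> cyl_shape P = cyl_shape Q ->
           exists2 pi, avoids_both d L pi & Phi pi = (P, Q))
      & (forall pi, avoids_both d L pi ->
           Phi (pi^-1)%g = ((Phi pi).2, (Phi pi).1))].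
Proof.
exists (@cylindric_RS d n); split.
- by move=> pi av; apply: (cylindric_RS_valid hd hL).
- by move=> pi1 pi2; apply: (cylindric_RS_inj hd hL).
- by move=> P Q; apply: (cylindric_RS_surj hd hL).
move=> pi av; congr pair; apply/eq_in_map => k; rewrite mem_iota => kn.
  exact: (pmat_rsV hd hL).
exact: (pmat_rsV hd hL).
Qed.
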